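(* For all integers $k,w\geq 1$, the maximum size of a ranked $k$-crossing-free antichain in $\mathbb{Z}^w$ is $k^{w-1}$.
   Context: $A[i]$ denotes the $i$th coordinate of $A\in\mathbb{Z}^w$, $1\leq i\leq w$. For $A,B\in\mathbb{Z}^w$, $A\leq B$ means $A[i]\leq B[i]$ for every coordinate $i$ (product order); antichains in $\mathbb{Z}^w$ are with respect to this order. Vectors $A,B\in\mathbb{Z}^w$ are $k$-crossing if there are coordinates $i$ and $j$ with $A[i]-B[i]\geq k$ and $B[j]-A[j]\geq k$. A family of vectors is $k$-crossing-free if it contains no two $k$-crossing vectors. The rank of $A\in\mathbb{Z}^w$ is the sum $A[1]+\cdots+A[w]$. An antichain in $\mathbb{Z}^w$ is ranked if all its vectors have the same rank. *)

(* Defs.v *)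
From mathcomp Require Import all_boot all_order all_algebra.
From mathcomp Require Import classical_sets cardinality.

Set Implicit Arguments.
Unset Strict Implicit.
Unset Printing Implicit Defensive.

Import Order.TTheory GRing.Theory Num.Theory.
Local Open Scope classical_set_scope.
Local Open Scope card_scope.
Local Open Scope ring_scope.

Section Vectors.

Variable w : nat.
Implicit Types (A B : 'rV[int]_w) (F : set 'rV[int]_w).

(* The i-th coordinate (1-based) of A is [A ord0 j] with j : 'I_w of value
   i - 1. *)

Definition vle A B : Prop := forall i : 'I_w, A ord0 i <= B ord0 i.

Definition crossing (k : nat) A B : Prop :=
  exists i j : 'I_w,
    k%:Z <= A ord0 i - B ord0 i /\ k%:Z <= B ord0 j - A ord0 j.

Definition crossing_free (k : nat) F : Prop :=
  forall A B, F A -> F B -> ~ crossing k A B.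

Definition antichain F : Prop :=
  forall A B, F A -> F B -> A <> B -> ~ vle A B.

Definition rank A : int := \sum_(i < w) A ord0 i.

Definition ranked F : Prop := forall A B, F A -> F B -> rank A = rank B.

End Vectors.

(* [n] is the maximum cardinality of a set in the class [P]. Infinite members
   of [P] are allowed a priori, and excluded by the second conjunct. *)
Definition is_max_size (T : Type) (P : set T -> Prop) (n : nat) : Prop :=
  (exists F : set T, P F /\ F #= `I_n) /\
  (forall F : set T, P F -> F #<= `I_n).

(* Main.v *)
Require Import Defs.
From mathcomp Require Import all_boot all_order all_algebra.
From mathcomp Require Import classical_sets cardinality.
From mathcomp Require Import zify.

(** Reduction modulo [k] of all coordinates but one is injective on a ranked
    [k]-crossing-free family. Indeed, if [A] and [B] have the same residues
    there, then, having the same rank, they are congruent modulo [k] in the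
    remaining coordinate too; if [A] and [B] are distinct, then equality of ranks
    gives coordinates where [A] is larger and where [B] is larger, and both
    differences, being positive multiples of [k], are at least [k]. The bound
    is attained by all vectors of rank 0 whose coordinates but one lie in
    [0, k - 1]. *)

Set Implicit Arguments.
Unset Strict Implicit.
Unset Printing Implicit Defensive.

Import Order.TTheory GRing.Theory Num.Theory.
Local Open Scope classical_set_scope.
Local Open Scope card_scope.
Local Open Scope ring_scope.

Lemma card_setT_finType (T : finType) : [set: T] #= `I_#|T|.
Proof.
have -> : `I_#|T| = (fun x : T => enum_rank x : nat) @` [set: T].
  apply/seteqP; split=> [n ltnT | _ [x _ <-]]; last exact: ltn_ord.
  by exists (enum_val (Ordinal ltnT)); rewrite ?enum_valK.
by apply/card_esym/inj_card_eq => x y _ _ /val_inj; exact: enum_rank_inj.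
Qed.

Lemma sum_coord_sub (w : nat) (A B : 'rV[int]_w) :
  rank A = rank B -> \sum_j (A ord0 j - B ord0 j) = 0.
Proof. by move=> eqr; rewrite sumrB -[LHS]/(rank A - rank B) eqr subrr. Qed.

(** The coordinate differences are nonnegative and sum to zero, so each of them vanishes. *)
Lemma vle_rank_eq (w : nat) (A B : 'rV[int]_w) :
  vle A B -> rank A = rank B -> A = B.
Proof.
move=> leAB eqr; apply/rowP => i; apply/esym/eqP; rewrite -subr_eq0.
have ge0 j : true -> 0 <= B ord0 j - A ord0 j by rewrite subr_ge0.
have /eqP := sum_coord_sub (esym eqr).
by rewrite psumr_eq0 // => /allP/(_ i (mem_index_enum _)).
Qed.

(** Otherwise [B] lies below [A] in the product order, and comparable vectors of equal rank
    coincide. *)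
Lemma same_rank_ltP (w : nat) (A B : 'rV[int]_w) :
  rank A = rank B -> A <> B -> exists i, A ord0 i < B ord0 i.
Proof.
move=> eqr neqAB; apply/existsP; apply: contra_notT neqAB => /existsPn geAB.
by apply/esym/vle_rank_eq => // i; rewrite leNgt.
Qed.

Lemma ranked_antichain (w : nat) (F : set 'rV[int]_w) : ranked F -> antichain F.
Proof. by move=> rF A B FA FB neqAB /vle_rank_eq/(_ (rF _ _ FA FB)). Qed.

Lemma crossing_of_congruent (k w : nat) (A B : 'rV[int]_w) :
    rank A = rank B -> A <> B ->
    (forall i, (k %| A ord0 i - B ord0 i)%Z) ->
  crossing k A B.
Proof.
have dvd_le (x y : int) : x < y -> (k %| y - x)%Z -> k%:Z <= y - x.
  by move=> ltxy; rewrite dvdzE /= => /dvdn_leq; lia.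
move=> eqr neqAB dvdAB.
have [i ltBA] := same_rank_ltP (esym eqr) (not_eq_sym neqAB).
have [j ltAB] := same_rank_ltP eqr neqAB.
exists i, j; split; apply: dvd_le => //.
by rewrite -opprB rpredN.
Qed.

Section Residues.

Variables k w : nat.

(** The coordinate left out is [ord0]. Remainders modulo [k.+1] lie between 0 and [k], so neither
    the absolute value nor [inord] alters them. *)
Definition residues (A : 'rV[int]_w.+1) : {ffun 'I_w -> 'I_k.+1} :=
  [ffun i => inord `|(A ord0 (lift ord0 i) %% k.+1)%Z|%N].

Lemma residues_congruent (A B : 'rV[int]_w.+1) :
    rank A = rank B -> residues A = residues B ->
  forall i, (k.+1 %| A ord0 i - B ord0 i)%Z.
Proof.
move=> eqr /ffunP eqres.
have dvd_lift i : (k.+1 %| A ord0 (lift ord0 i) - B ord0 (lift ord0 i))%Z.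
  have modE (x : int) : `|(x %% k.+1)%Z|%N%:Z = (x %% k.+1)%Z by lia.
  have := congr1 val (eqres i); rewrite !ffunE /= !inordK; try lia.
  by move/(congr1 Posz); rewrite !modE => /eqP; rewrite eqz_mod_dvd.
move=> i; case: (unliftP ord0 i) => [j -> // | ->].
have /eqP := sum_coord_sub eqr.
(* The differences sum to zero, so the one at [ord0] is minus the sum of the others. *)
rewrite big_ord_recl addr_eq0 => /eqP ->.
by rewrite rpredN; apply: rpred_sum => j _; exact: dvd_lift.
Qed.

(** The entries away from [ord0] are free in the box; the one at [ord0] is then forced by rank 0. *)
Definition box_vector (f : {ffun 'I_w -> 'I_k.+1}) : 'rV[int]_w.+1 :=
  \row_j (if unlift ord0 j is Some i then (f i)%:Z
          else - \sum_(i < w) (f i)%:Z).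

Lemma box_vector_lift (f : {ffun 'I_w -> 'I_k.+1}) (i : 'I_w) :
  box_vector f ord0 (lift ord0 i) = (f i)%:Z.
Proof. by rewrite mxE liftK. Qed.

Lemma box_vector_inj : injective box_vector.
Proof.
move=> f g eqfg; apply/ffunP => i; apply/val_inj/eqP.
by rewrite -eqz_nat -!box_vector_lift eqfg.
Qed.

Lemma rank_box_vector (f : {ffun 'I_w -> 'I_k.+1}) : rank (box_vector f) = 0.
Proof.
rewrite /rank big_ord_recl mxE unlift_none addrC.
by under eq_bigr do rewrite box_vector_lift; rewrite subrr.
Qed.

Lemma ranked_box : ranked (range box_vector).
Proof. by move=> _ _ [f _ <-] [g _ <-]; rewrite !rank_box_vector. Qed.

(* A difference of at least [k.+1] can only occur in coordinate [ord0]. *)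
Lemma crossing_free_box : crossing_free k.+1 (range box_vector).
Proof.
move=> _ _ [f _ <-] [g _ <-] [i [j []]].
case: (unliftP ord0 i) => [i' -> | ->].
  by rewrite !box_vector_lift; have := ltn_ord (f i'); lia.
(* If [i] and [j] are both [ord0], a single difference would have to be both positive and
   negative. *)
case: (unliftP ord0 j) => [j' -> | ->]; last by lia.
by rewrite !box_vector_lift; have := ltn_ord (g j'); lia.
Qed.

End Residues.

Lemma ranked_crossing_free_inj (k w : nat) (F : set 'rV[int]_w.+1) :
  ranked F -> crossing_free k.+1 F -> {in F &, injective (@residues k w)}.
Proof.
move=> rF cF A B; rewrite !inE => FA FB eqres; apply/eqP.
apply: contra_notT (cF A B FA FB) => /eqP neqAB.
apply: crossing_of_congruent (rF _ _ FA FB) neqAB _.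
exact: residues_congruent (rF _ _ FA FB) eqres.
Qed.

Theorem proposition16 (k w : nat) (hk : (1 <= k)%N) (hw : (1 <= w)%N) :
  is_max_size
    (fun F : set 'rV[int]_w => antichain F /\ ranked F /\ crossing_free k F)
    (k ^ (w - 1))%N.
Proof.
case: k w hk hw => [//|k] [//|w] _ _; rewrite subn1 /=.
have -> : (k.+1 ^ w)%N = #|{ffun 'I_w -> 'I_k.+1}| by rewrite card_ffun !card_ord.
split=> [|F [_ [rF cF]]].
  exists (range (@box_vector k w)); split.
    by split; [exact/ranked_antichain/ranked_box
              | split; [exact: ranked_box | exact: crossing_free_box]].
  apply: card_eq_trans (card_setT_finType _).
  by apply: inj_card_eq => f g _ _; exact: box_vector_inj.
(* By injectivity, [F] is equinumerous with its image under [residues], a subset of a finite type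
   with the required number of elements. *)
rewrite -(card_le_eql (inj_card_eq (ranked_crossing_free_inj rF cF))).
by rewrite -(card_le_eqr (card_setT_finType _)) card_leT.
Qed.
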